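(* Let $(U,d)$ and $(U',d')$ be bounded distortion equivalent ultrametric spaces. If the metrics $d$ and $d'$ are pseudo-discrete, then $\varrho(U,U')=0$ if and only if $(U,d)$ and $(U',d')$ have the same branching.
   Context: Distortion: for a homeomorphism $f\colon X\to Y$ of metric spaces $(X,d_X),(Y,d_Y)$, $x_0\in X$, $\varepsilon>0$ and $S(x_0,\varepsilon)=\{x\in X : d_X(x_0,x)=\varepsilon\}$, set $$D_f(x_0,\varepsilon)=\frac{\sup\{d_Y(f(x_0),f(x)) : d_X(x_0,x)=\varepsilon\}}{\inf\{d_Y(f(x_0),f(x)) : d_X(x_0,x)=\varepsilon\}}$$ if $S(x_0,\varepsilon)\neq\emptyset$, and $D_f(x_0,\varepsilon)=1$ if $S(x_0,\varepsilon)=\emptyset$. The homeomorphism $f$ has bounded distortion if there is $K>0$ with $\sup_{x\in X}\sup_{\varepsilon>0}D_f(x,\varepsilon)\le K$; it is a bounded distortion equivalence if both $f$ and $f^{-1}$ have bounded distortion. Two spaces are bounded distortion equivalent if there is a bounded distortion equivalence between them. The map $\varrho$: for bounded distortion equivalent ultrametric spaces $U,U'$, let $\mathcal{K}_{U,U'}$ be the greatest lower bound of the $K$ for which there is a homeomorphism $f\colon U\to U'$ with $\sup_{x\in U}\sup_{\varepsilon>0}D_f(x,\varepsilon)\le K$ and $\sup_{x'\in U'}\sup_{\varepsilon>0}D_{f^{-1}}(x',\varepsilon)\le K$. Define $\varrho(U,U')=\ln(1+2\ln(\mathcal{K}_{U,U'}))$. Pseudo-discrete: a metric $d$ on $X$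 is pseudo-discrete if there is some $\delta>1$ such that for every non-empty sphere $S(x,r)$ ($r>0$) and every $y\in X$ with $\frac{r}{\delta}<d(y,x)<r\delta$ one has $d(x,y)=r$. Branching: a bijection $h\colon(U,d)\to(U',d')$ between ultrametric spaces preserves the branching if for all $x,y,z\in U$: $d(x,y)=d(x,z)$ implies $d'(h(x),h(y))=d'(h(x),h(z))$, and $d(x,y)<d(x,z)$ implies $d'(h(x),h(y))<d'(h(x),h(z))$. The two spaces have the same branching if such a bijection exists. *)

(* Defs.v *)
From mathcomp Require Import all_boot all_order all_algebra.
From mathcomp Require Import all_classical all_reals all_analysis.

Set Implicit Arguments.
Unset Strict Implicit.
Unset Printing Implicit Defensive.

Import Order.TTheory GRing.Theory Num.Theory.
Import numFieldNormedType.Exports.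

Local Open Scope classical_set_scope.
Local Open Scope ring_scope.

Definition ultrametric (R : realType) (U : metricType R) : Prop :=
  forall x y z : U, mdist x z <= Num.max (mdist x y) (mdist y z).

Definition metric_sphere (R : realType) (X : metricType R) (x0 : X) (e : R)
  : set X := [set x | mdist x0 x = e].

Definition homeomorphism (X Y : topologicalType) (f : X -> Y) (g : Y -> X)
  : Prop := [/\ cancel f g, cancel g f, continuous f & continuous g].

(* Extended-real valued: the supremum over a sphere may be +oo. For a
   homeomorphism and e > 0 the infimum in the denominator is positive and
   finite, so the conventions for 0^-1 and (+oo)^-1 play no role. *)
Definition distortion (R : realType) (X Y : metricType R) (f : X -> Y)
    (x0 : X) (e : R) : \bar R :=
  if `[< metric_sphere x0 e !=set0 >] then
    (ereal_sup [set (mdist (f x0) (f x))%:E | x in metric_sphere x0 e]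
     / ereal_inf [set (mdist (f x0) (f x))%:E | x in metric_sphere x0 e])%E
  else 1%E.

Definition max_distortion (R : realType) (X Y : metricType R) (f : X -> Y)
  : \bar R :=
  ereal_sup [set ereal_sup [set distortion f x e | e in [set e : R | 0 < e]]
            | x in [set: X]].

Definition bounded_distortion (R : realType) (X Y : metricType R)
    (f : X -> Y) : Prop :=
  exists2 K : R, 0 < K & (max_distortion f <= K%:E)%E.

Definition bounded_distortion_equivalence (R : realType) (X Y : metricType R)
    (f : X -> Y) (g : Y -> X) : Prop :=
  [/\ homeomorphism f g, bounded_distortion f & bounded_distortion g].

Definition bounded_distortion_equivalent (R : realType) (X Y : metricType R)
  : Prop :=
  exists (f : X -> Y) (g : Y -> X), bounded_distortion_equivalence f g.

(* For nonempty bounded distortion equivalent spaces the set is nonempty and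
   bounded below by 1, so that [inf] is its greatest lower bound. If both
   spaces are empty, the set is all of R, [inf] is 0 by convention and, as
   [ln 0 = 0], the value of [varrho] below is 0. *)
Definition distortion_constant (R : realType) (U U' : metricType R) : R :=
  inf [set K : R | exists (f : U -> U') (g : U' -> U),
         [/\ homeomorphism f g, (max_distortion f <= K%:E)%E
           & (max_distortion g <= K%:E)%E]].

Definition varrho (R : realType) (U U' : metricType R) : R :=
  ln (1 + 2 * ln (distortion_constant U U')).

Definition pseudo_discrete (R : realType) (X : metricType R) : Prop :=
  exists2 delta : R, 1 < delta &
    forall (x : X) (r : R), 0 < r -> metric_sphere x r !=set0 ->
    forall y : X, r / delta < mdist y x < r * delta -> mdist x y = r.

Definition preserves_branching (R : realType) (U U' : metricType R)
    (h : U -> U') : Prop :=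
  forall x y z : U,
    (mdist x y = mdist x z -> mdist (h x) (h y) = mdist (h x) (h z)) /\
    (mdist x y < mdist x z -> mdist (h x) (h y) < mdist (h x) (h z)).

Definition same_branching (R : realType) (U U' : metricType R) : Prop :=
  exists2 h : U -> U', bijective h & preserves_branching h.

(* Main.v *)
Require Import Defs.
From mathcomp Require Import all_boot all_order all_algebra.
From mathcomp Require Import all_classical all_reals all_analysis.
From mathcomp Require Import lra.

(** If a homeomorphism [h] and its inverse have distortion at most [K], then
    two points at the same distance from [x] have images whose distances to
    [h x] have a ratio between [1 / K] and [K].  In a pseudo-discrete metric
    with gap [delta > K], a ratio of two distances to one point cannot lie
    strictly between [1 / delta] and [delta] without being [1]; hence [h] and
    its inverse send spheres into spheres
    ([max_distortion_preserves_spheres]).  In an ultrametric space this already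
    forces the order of the radii to be preserved: if [d x y < d x z] then
    [x] and [y] lie on a common sphere about [z], so their images do too, the
    image triangle is isosceles with apex [h z], and the base is strictly
    shorter than the legs because equality would pull back
    ([preserves_spheres_branching]).  As [varrho U U' = 0] forces the
    distortion constant to be at most [1], it provides such homeomorphisms
    for some [K] below the gaps of both spaces.

    Conversely, a bijection that preserves the branching, and its inverse, map
    spheres into spheres, so both have distortion [1].  They are continuous
    because of the gap: around a non-isolated point the radii of images
    decrease strictly, and each strict decrease is by a factor at least
    [delta], so they tend to [0] ([preserves_branching_continuous]).  If the
    spaces are nonempty, the distortion constant is then exactly [1]: it is at
    least [1] because the distortion is [1] by convention on an empty sphere
    of positive radius, which exists by pseudo-discreteness.  If they are
    empty, it is [0] and [varrho U U' = 0] as well. *)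

Set Implicit Arguments.
Unset Strict Implicit.
Unset Printing Implicit Defensive.

Import Order.TTheory GRing.Theory Num.Theory.
Import numFieldNormedType.Exports.

Local Open Scope classical_set_scope.
Local Open Scope ring_scope.

(** * Distortion and spheres *)

Section Distortion.
Variables (R : realType) (X Y : metricType R).
Implicit Types (f : X -> Y) (K e : R).

(** The map sends every sphere about [x] into a sphere about [f x]; radius [0]
    is included, where this holds for every map. *)
Definition preserves_spheres f :=
  forall x y z : X, mdist x y = mdist x z ->
    mdist (f x) (f y) = mdist (f x) (f z).

Lemma distortion_le_max f x e : 0 < e ->
  (distortion f x e <= max_distortion f)%E.
Proof.
move=> e0; apply: (@le_trans _ _
  (ereal_sup [set distortion f x e | e in [set e : R | 0 < e]])).
  by apply: ereal_sup_ubound; exists e.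
by apply: ereal_sup_ubound; exists x.
Qed.

Lemma max_distortion_le_ratio f K (x y z : X) : injective f ->
  (max_distortion f <= K%:E)%E -> x != y -> mdist x y = mdist x z ->
  mdist (f x) (f y) <= K * mdist (f x) (f z).
Proof.
move=> finj fK xy yz.
have fxy : 0 < mdist (f x) (f y) by rewrite mdist_gt0 (inj_eq finj).
have e0 : 0 < mdist x y by rewrite mdist_gt0.
have := le_trans (distortion_le_max f x e0) fK.
rewrite /distortion asboolT; last by exists y.
set S := [set _ | _ in _].
have Sy : S (mdist (f x) (f y))%:E by exists y.
have Sz : S (mdist (f x) (f z))%:E.
  by exists z => //; rewrite /metric_sphere /= yz.
have aP := ereal_sup_ubound Sy; have bP := ereal_inf_lbound Sz.
have b0 : (0 <= ereal_inf S)%E.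
  by apply: le_ereal_inf_tmp => _ [t _ <-]; rewrite lee_fin mdist_ge0.
case: (ereal_inf S) bP b0 => [r| |] //; rewrite !lee_fin => rP r0.
have a0 : (0 < ereal_sup S)%E by apply: lt_le_trans aP; rewrite lte_fin.
rewrite inver; case: eqP => [_|/eqP rN0].
(* a vanishing infimum would make the quotient infinite *)
  by rewrite gt0_muley.
rewrite lee_pdivrMr; last by rewrite lt_neqAle eq_sym rN0.
move=> /(le_trans aP); rewrite -EFinM lee_fin => aK.
apply: (le_trans aK); apply: ler_wpM2l => //.
rewrite leNgt; apply/negP => K0.
by have := lt_le_trans fxy aK; rewrite ltNge mulr_le0_ge0 // ltW.
Qed.

Lemma preserves_spheres_max_distortion f : injective f ->
  preserves_spheres f -> (max_distortion f <= 1%:E)%E.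
Proof.
move=> finj fS; apply: ge_ereal_sup => _ [x _ <-].
apply: ge_ereal_sup => _ [e /= e0 <-]; rewrite /distortion.
case: asboolP => [[y xy]|//].
have xNy : x != y by rewrite -mdist_gt0 xy.
have -> : [set (mdist (f x) (f t))%:E | t in metric_sphere x e]
          = [set (mdist (f x) (f y))%:E].
  apply/seteqP; split=> [_ [t xt <-] | _ ->]; last by exists y.
  by congr (_%:E); apply: fS; rewrite xt xy.
have c0 : mdist (f x) (f y) != 0.
  by rewrite gt_eqF // mdist_gt0 (inj_eq finj).
by rewrite ereal_sup1 ereal_inf1 inver (negbTE c0) -EFinM divff.
Qed.

End Distortion.

(** * Pseudo-discreteness *)

Section Gap.
Variables (R : realType) (X : metricType R).

(** The multiplicative gap between distinct radii from one centre. *)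
Lemma pseudo_discrete_gap : pseudo_discrete X ->
  exists2 delta : R, 1 < delta & forall x y z : X, x != z ->
    mdist x z < delta * mdist x y -> mdist x y < delta * mdist x z ->
    mdist x y = mdist x z.
Proof.
move=> [delta d1 pd]; exists delta => // x y z xz zy yz.
have d0 : 0 < delta by apply: lt_trans d1.
apply: (pd x (mdist x z)); first by rewrite mdist_gt0.
  by exists z.
by rewrite (metric_sym y) ltr_pdivrMr // mulrC zy mulrC yz.
Qed.

Lemma pseudo_discrete_empty_sphere (x : X) : pseudo_discrete X ->
  exists2 e : R, 0 < e & metric_sphere x e = set0.
Proof.
move=> [delta d1 pd].
have [xN0|/set0P/negP/negPn/eqP] := pselect (metric_sphere x 1 !=set0);
  last by exists 1.
exists ((1 + delta) / 2); first lra.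
apply/seteqP; split=> // y xy.
have := pd x 1 ltr01 xN0 y; rewrite (metric_sym y) xy => H.
have : (1 + delta) / 2 = 1.
  by apply: H; rewrite ltr_pdivrMr; [apply/andP; split; nra | lra].
lra.
Qed.

End Gap.

Section PseudoDiscrete.
Variables (R : realType) (X Y : metricType R).

(** The gap of the target bounds the distortions that force spheres to be
    preserved, uniformly in the map. *)
Lemma max_distortion_preserves_spheres : pseudo_discrete Y ->
  exists2 delta : R, 1 < delta &
    forall (K : R) (f : X -> Y), K < delta -> injective f ->
      (max_distortion f <= K%:E)%E -> preserves_spheres f.
Proof.
move=> /pseudo_discrete_gap[delta d1 gap]; exists delta => // K f Kd finj fK.
move=> x y z yz; have [xy|xy] := eqVneq x y.
  have <- : x = z by apply: mdist_positivity; rewrite -yz xy mdistxx.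
  by rewrite xy.
have xz : x != z by rewrite -mdist_gt0 -yz mdist_gt0.
have lt_delta t u : f x != f u -> mdist (f x) (f t) <= K * mdist (f x) (f u) ->
    mdist (f x) (f t) < delta * mdist (f x) (f u).
  by move=> xu /le_lt_trans; apply; rewrite ltr_pM2r // mdist_gt0.
apply: gap; first by rewrite (inj_eq finj).
  apply: lt_delta; first by rewrite (inj_eq finj).
  exact: max_distortion_le_ratio.
apply: lt_delta; first by rewrite (inj_eq finj).
exact: max_distortion_le_ratio.
Qed.

(** Preserving the branching alone does not give continuity, as the radii of
    images could decrease to a positive limit; the gap in the target excludes
    this. *)
Lemma preserves_branching_continuous (h : X -> Y) : pseudo_discrete Y ->
  injective h -> preserves_branching h -> continuous h.
Proof.
move=> /pseudo_discrete_gap[delta d1 gap] hinj hB x.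
apply/metricType_numDomainType.cvgrPdist_lt => e e0.
have [[y [xy hxy]]|noy] :=
    pselect (exists y, x != y /\ mdist (h x) (h y) < e).
  apply/metricType_numDomainType.nbhs_mdistP.
  exists (mdist x y) => /=; first by rewrite mdist_gt0.
  by move=> t /= xt; apply: lt_trans hxy; apply: (hB x t y).2.
have he y : x != y -> e <= mdist (h x) (h y).
  by move=> xy; rewrite leNgt; apply/negP => hxy; apply: noy; exists y.
(* the radii of images are bounded away from 0, so [x] must be isolated *)
have [[r r0 xr]|nis] :=
    pselect (exists2 r : R, 0 < r & forall y, mdist x y < r -> x = y).
  apply/metricType_numDomainType.nbhs_mdistP.
  by exists r => //= t /= /xr <-; rewrite mdistxx.
have near_x r : 0 < r -> exists2 y, x != y & mdist x y < r.
  move=> r0; apply: contrapT => H; apply: nis; exists r => // y xyr.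
  by apply: contrapT => /eqP xy; apply: H; exists y.
pose E := [set mdist (h x) (h y) | y in [set y | x != y]].
have E0 : E !=set0.
  by have [y xy _] := near_x 1 ltr01; exists (mdist (h x) (h y)); exists y.
have Elb : has_lbound E by exists e => _ [y xy <-]; apply: he.
have m0 : 0 < inf E.
  by apply: (lt_le_trans e0); apply: lb_le_inf => // _ [y xy <-]; apply: he.
(* a radius just above the infimum has a strictly smaller successor, which the
   gap pushes below the infimum *)
suff : delta * inf E <= inf E by rewrite ger_pMl // leNgt d1.
apply: lb_le_inf => // _ [y xy <-].
have [z xz zy] : exists2 z, x != z & mdist x z < mdist x y.
  by apply: near_x; rewrite mdist_gt0.
have hzy := (hB x z y).2 zy.
apply: (@le_trans _ _ (delta * mdist (h x) (h z))).
  rewrite ler_pM2l; last exact: lt_trans d1.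
  by apply: ge_inf => //; exists z.
rewrite leNgt; apply/negP => lt_y.
have : mdist (h x) (h z) = mdist (h x) (h y).
  apply: gap => //; first by rewrite (inj_eq hinj).
  apply: (lt_trans hzy); rewrite ltr_pMl //.
  by apply: le_lt_trans hzy; apply: mdist_ge0.
by move=> hE; rewrite hE ltxx in hzy.
Qed.

End PseudoDiscrete.

(** * Branching *)

Section Branching.
Variables (R : realType) (U U' : metricType R).

Lemma preserves_branching_inverse (h : U -> U') (g : U' -> U) :
  cancel g h -> preserves_branching h -> preserves_branching g.
Proof.
move=> gK hB x y z.
have B := hB (g x) (g y) (g z); have B' := hB (g x) (g z) (g y).
rewrite !gK in B B'.
by split; case: (ltgtP (mdist (g x) (g y)) (mdist (g x) (g z)));
  move=> // H; [have := B.2 H|have := B'.2 H|have := B'.2 H|have := B.1 H]; lra.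
Qed.

(** Ultrametricity of both spaces turns the preservation of equality of radii
    into the preservation of their order. *)
Lemma preserves_spheres_branching (h : U -> U') (g : U' -> U) :
  ultrametric U -> ultrametric U' -> cancel h g ->
  preserves_spheres h -> preserves_spheres g -> preserves_branching h.
Proof.
move=> uU uU' hK hS gS x y z; split; first exact: hS.
move=> xyz.
(* the triangle [x], [y], [z] is isosceles with apex [z] *)
have zxy : mdist z x = mdist z y.
  rewrite !(metric_sym z); apply/eqP; rewrite eq_le.
  have := uU x y z; have := uU y x z; rewrite (metric_sym y x) !le_max.
  by move=> /orP[]? /orP[]?; apply/andP; split; lra.
have hz := hS _ _ _ zxy.
have le_h : mdist (h x) (h y) <= mdist (h x) (h z).
  by have := uU' (h x) (h z) (h y); rewrite -hz (metric_sym (h z)) maxxx.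
rewrite lt_neqAle le_h andbT; apply/eqP => hE.
by have := gS _ _ _ hE; rewrite !hK; lra.
Qed.

End Branching.

(** * The distortion constant *)

Section DistortionConstant.
Variables (R : realType) (U U' : metricType R).

Lemma varrho0_distortion_constant_le1 :
  varrho U U' = 0 -> distortion_constant U U' <= 1.
Proof.
rewrite /varrho => rho0; rewrite leNgt; apply/negP => K1.
have := ln_gt0 K1 => lnK.
by have := @ln_gt0 R (1 + 2 * ln (distortion_constant U U')); rewrite rho0; lra.
Qed.

Lemma same_branching_varrho0 : pseudo_discrete U -> pseudo_discrete U' ->
  same_branching U U' -> varrho U U' = 0.
Proof.
move=> pdU pdU' [h [g hK gK] hB].
have gB := preserves_branching_inverse gK hB.
have hinj := can_inj hK; have ginj := can_inj gK.
rewrite /varrho; suff -> : ln (distortion_constant U U') = 0.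
  by rewrite mulr0 addr0 ln1.
rewrite /distortion_constant; set S := [set K | _].
have [[x _]|U0] := pselect ([set: U] !=set0).
  have S1 : S 1.
    exists h, g; split; first split=> //.
    - exact: preserves_branching_continuous.
    - exact: preserves_branching_continuous.
    - by apply: preserves_spheres_max_distortion => // a b c;
        apply: (hB a b c).1.
    - by apply: preserves_spheres_max_distortion => // a b c;
        apply: (gB a b c).1.
  have S_ge1 : lbound S 1.
    move=> K [f [f' [_ fK _]]].
    have [e e0 xe] := pseudo_discrete_empty_sphere x pdU.
    have := le_trans (distortion_le_max f x e0) fK.
    rewrite /distortion asboolF ?lee_fin // xe.
    by case=> y.
  suff -> : inf S = 1 by rewrite ln1.
  apply/eqP; rewrite eq_le; apply/andP; split.
    by apply: ge_inf => //; exists 1.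
  by apply: lb_le_inf => //; exists 1.
(* on empty spaces the supremum over all points is -oo, so every [K] is
   admissible and the infimum takes its default value 0 *)
have U_empty (x : U) : False by apply: U0; exists x.
have ST K : S K.
  exists h, g; split; first split=> //.
  - by move=> y; case: (U_empty (g y)).
  - by apply: ge_ereal_sup => _ [x _ <-]; case: (U_empty x).
  - by apply: ge_ereal_sup => _ [y _ <-]; case: (U_empty (g y)).
rewrite inf_out ?ln0 // => -[_ [m mS]].
by have := mS _ (ST (m - 1)); rewrite lerBrDr gerDl ler10.
Qed.

End DistortionConstant.

Theorem theorem1p1 (R : realType) (U U' : metricType R)
    (ultraU : ultrametric U) (ultraU' : ultrametric U')
    (bdeUU' : bounded_distortion_equivalent U U')
    (pdU : pseudo_discrete U) (pdU' : pseudo_discrete U') :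
  varrho U U' = 0 <-> same_branching U U'.
Proof.
split; last exact: same_branching_varrho0.
move=> /varrho0_distortion_constant_le1 c1.
have [delta d1 hS] := max_distortion_preserves_spheres U pdU'.
have [delta' d'1 gS] := max_distortion_preserves_spheres U' pdU.
have [f [g [fg [K0 _ fK0] [K1 _ gK1]]]] := bdeUU'.
pose m := Num.min delta delta'.
have m1 : 1 < m by rewrite lt_min d1.
(* the infimum is at most 1 and the bounded distortion equivalence makes the
   set of admissible [K] nonempty, so some admissible [K] lies below [m] *)
have [K [h [h' [[hK h'K _ _] hle h'le]] Km]] : exists2 K : R,
    (exists (h : U -> U') (h' : U' -> U), [/\ homeomorphism h h',
      (max_distortion h <= K%:E)%E & (max_distortion h' <= K%:E)%E]) & K < m.
  apply: contrapT => noK.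
  have : m <= distortion_constant U U'.
    apply: lb_le_inf.
      exists (Num.max K0 K1), f, g; split=> //.
        by apply: le_trans fK0 _; rewrite lee_fin le_max lexx.
      by apply: le_trans gK1 _; rewrite lee_fin le_max lexx orbT.
    by move=> K hK; rewrite leNgt; apply/negP => Km; apply: noK; exists K.
  lra.
move: Km; rewrite lt_min => /andP[Kd Kd'].
exists h; first by exists h'.
apply: (preserves_spheres_branching ultraU ultraU' hK).
  by apply: (hS K) => //; apply: can_inj hK.
by apply: (gS K) => //; apply: can_inj h'K.
Qed.
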